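(* Let $T$ be a finite irreducible rooted tree (i.e., no node of $T$ has exactly one child). Then $T$ is an IR-tree if and only if $T$ has no node that has exactly two children of which exactly one is a leaf.
   Context: Graphs are finite and undirected. A coloring of a graph $G=(V,E)$ is a surjective map $\pi\colon V\to\{1,\dots,k\}$; its cells are the sets $\pi^{-1}(i)$; it is discrete if all cells are singletons. A coloring $\pi$ is finer than $\pi'$ if $\pi(v)=\pi(v')$ implies $\pi'(v)=\pi'(v')$. A coloring is equitable if for all colors $i,j$ all $i$-colored vertices have the same number of $j$-colored neighbors. For a colored graph $(G,\pi)$ and a sequence $\nu$ of vertices, $\mathrm{Ref}(G,\pi,\nu)$ denotes the (unique up to renaming of colors, computed isomorphism-invariantly) coarsest equitable coloring finer than $\pi$ in which every vertex of $\nu$ forms a singleton cell, where the $i$-th vertex of $\nu$ receives the $i$-th of a set of special ''individualization'' colors distinct from all other colors (this is the result of individualization followed by color refinement). A cell selector is a function $\mathrm{Sel}$ mapping a graph $G$ with coloring $\pi$ to a set of vertices such that: $\mathrm{Sel}(G^\varphi,\pi^\varphi)=\mathrm{Sel}(G,\pi)^\varphi$ for every permutation $\varphi$ of the vertices; if $\pi$ is discrete then $\mathrm{Sel}(G,\pi)=\emptyset$; if $\pi$ is not discrete then $\mathrm{Sel}(G,\pi)$ is a cell of $\pi$ of size greater than $1$. The IR-tree $\Gamma_{\mathrm{Sel}}(G,\pi)$ is the rooted tree whose nodes are sequences of vertices of $G$: the root is the empty sequence $\epsilon$, and the children of a node $\nu$ are the sequences $\nu.v$ for $v\in \mathrm{Sel}(G,\mathrm{Ref}(G,\pi,\nu))$.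 A rooted tree $T$ is called an IR-tree if there exist a colored graph $(G,\pi)$ and a cell selector $\mathrm{Sel}$ such that $\Gamma_{\mathrm{Sel}}(G,\pi)$ is isomorphic to $T$ as a rooted tree. *)

(* Defs.v *)
From mathcomp Require Import all_boot fingroup perm.
Set Implicit Arguments. Unset Strict Implicit. Unset Printing Implicit Defensive.

Section GraphDefs.
Variable V : finType.

Definition simple_graph (G : rel V) : Prop := symmetric G /\ irreflexive G.

Definition is_coloring (pi : V -> nat) : Prop :=
  exists k : nat, forall c : nat, (exists v, pi v = c) <-> (1 <= c <= k).

Definition cell (pi : V -> nat) (v : V) : {set V} := [set w | pi w == pi v].

Definition is_cell (pi : V -> nat) (C : {set V}) : Prop := exists v, C = cell pi v.

Definition singleton_cell (pi : V -> nat) (v : V) : Prop := cell pi v = [set v].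

Definition discrete (pi : V -> nat) : Prop := forall v, singleton_cell pi v.

Definition finer (pi pi' : V -> nat) : Prop :=
  forall v w, pi v = pi w -> pi' v = pi' w.

Definition equitable (G : rel V) (pi : V -> nat) : Prop :=
  forall v w, pi v = pi w -> forall c : nat,
    #|[set u | G v u && (pi u == c)]| = #|[set u | G w u && (pi u == c)]|.

Definition relabel_graph (phi : {perm V}) (G : rel V) : rel V :=
  fun x y => G ((phi^-1)%g x) ((phi^-1)%g y).
Definition relabel_col (phi : {perm V}) (pi : V -> nat) : V -> nat :=
  fun x => pi ((phi^-1)%g x).

(* Specification of Ref(G,pi,nu) (individualization + color refinement):
   a coloring; equitable; finer than pi; every vertex of nu is a singleton;
   coarsest such; the i-th vertex of nu (0-based) gets the special color i+1
   (the individualization colors are 1,...,|nu|); isomorphism invariant. *)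
Definition refinement_spec
  (Ref : rel V -> (V -> nat) -> seq V -> V -> nat) : Prop :=
  forall (G : rel V) (pi : V -> nat) (nu : seq V),
    simple_graph G -> is_coloring pi ->
    is_coloring (Ref G pi nu) /\
    equitable G (Ref G pi nu) /\
    finer (Ref G pi nu) pi /\
    (forall v, v \in nu -> singleton_cell (Ref G pi nu) v) /\
    (forall rho : V -> nat, equitable G rho -> finer rho pi ->
       (forall v, v \in nu -> singleton_cell rho v) ->
       finer rho (Ref G pi nu)) /\
    (uniq nu -> forall (d : V) (i : nat), i < size nu ->
       Ref G pi nu (nth d nu i) = i.+1) /\
    (forall phi : {perm V},
       Ref (relabel_graph phi G) (relabel_col phi pi) (map phi nu)
       =1 relabel_col phi (Ref G pi nu)).

Definition cell_selector (Sel : rel V -> (V -> nat) -> {set V}) : Prop :=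
  forall (G : rel V) (pi : V -> nat), simple_graph G -> is_coloring pi ->
    [/\ (forall phi : {perm V},
           Sel (relabel_graph phi G) (relabel_col phi pi) = phi @: Sel G pi),
        (discrete pi -> Sel G pi = set0)
      & (~ discrete pi -> is_cell pi (Sel G pi) /\ 1 < #|Sel G pi|)].

Inductive ir_node (Ref : rel V -> (V -> nat) -> seq V -> V -> nat)
  (Sel : rel V -> (V -> nat) -> {set V}) (G : rel V) (pi : V -> nat)
  : seq V -> Prop :=
| ir_root : ir_node Ref Sel G pi [::]
| ir_child (nu : seq V) (v : V) :
    ir_node Ref Sel G pi nu -> v \in Sel G (Ref G pi nu) ->
    ir_node Ref Sel G pi (rcons nu v).

End GraphDefs.

(* A finite rooted tree: node type T, root r, parent map p with p r = r, and
   every node reaches the root by iterating p. *)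
Section TreeDefs.
Variables (T : finType) (r : T) (p : T -> T).

Definition rooted_tree : Prop := p r = r /\ forall t, exists n, iter n p t = r.

Definition children (t : T) : {set T} := [set u | (u != r) && (p u == t)].

Definition is_leaf (t : T) : bool := children t == set0.

Definition irreducible_tree : Prop := forall t, #|children t| <> 1.

Definition bad_node (t : T) : Prop :=
  #|children t| = 2 /\ #|[set u in children t | is_leaf u]| = 1.

Definition iso_to_ir_tree (V : finType) Ref Sel (G : rel V) (pi : V -> nat)
  (f : T -> seq V) : Prop :=
  [/\ injective f,
      (forall nu, ir_node Ref Sel G pi nu <-> exists t, f t = nu),
      f r = [::]
    & (forall t, t != r -> exists v, f t = rcons (f (p t)) v)].

Definition is_IR_tree
  (Ref : forall V : finType, rel V -> (V -> nat) -> seq V -> V -> nat) : Prop :=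
  exists (V : finType) (G : rel V) (pi : V -> nat)
         (Sel : rel V -> (V -> nat) -> {set V}),
    [/\ simple_graph G, is_coloring pi, cell_selector Sel
      & exists f : T -> seq V, iso_to_ir_tree (Ref V) Sel G pi f].

End TreeDefs.

(* Main.v *)
Require Import Defs.
From mathcomp Require Import all_boot fingroup perm.
From mathcomp Require Import zify.
Set Implicit Arguments. Unset Strict Implicit. Unset Printing Implicit Defensive.

(** If a node [nu] selects a cell [{v, w}], individualizing [v] also makes [w] a
    singleton, so [nu.v] and [nu.w] refine to the same partition; hence both
    children are leaves or none is.

    Conversely, take the nodes of the tree as core vertices, siblings sharing a
    colour, so that the children of an inner node form a cell. Refinement has to
    keep that cell intact when inner nodes are individualized, but must become
    discrete as soon as a leaf is. For a leaf [l] and a node [y], this is done by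
    a relation on tuples [(s0, s1, s2, s3, s4)] of nodes: the parity
    [(s1 == s2) (+) (s3 == s4)], flipped when [s0 = y], [s1, s2] are in [{l, a}]
    and [s3, s4] are in [{l, b}], where [a] and [b] are siblings of [l]. The flip
    can be undone by exchanging [l] with [a] (or with [b]) in a single entry, so
    colour refinement does not see it as long as [l] and [a], or [l] and [b],
    have the same colour; but when [l] is a singleton, the entry
    [(y, l, l, l, l)] singles out [y]. An inner node on the current branch
    equals at most one of [a] and [b], provided that [a = b] only happens for
    leaves, which is possible exactly because no node has two children of which
    one is a leaf.

    Finally, the graph is made rigid by a path encoding the colours, so that the
    cell selector may be prescribed arbitrarily on it. *)

(** * Necessity *)

Section Refinement.
Variables (V : finType) (Ref : rel V -> (V -> nat) -> seq V -> V -> nat).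
Hypothesis HRef : refinement_spec Ref.
Variables (G : rel V) (pi : V -> nat).
Hypotheses (Gs : simple_graph G) (pic : is_coloring pi).

Lemma ref_coloring nu : is_coloring (Ref G pi nu).
Proof. by case: (HRef nu Gs pic). Qed.

Lemma ref_equitable nu : equitable G (Ref G pi nu).
Proof. by case: (HRef nu Gs pic) => _ []. Qed.

Lemma ref_finer nu : finer (Ref G pi nu) pi.
Proof. by case: (HRef nu Gs pic) => _ [_ []]. Qed.

Lemma ref_singleton nu v : v \in nu -> singleton_cell (Ref G pi nu) v.
Proof. by case: (HRef nu Gs pic) => _ [_ [_ [+ _]]]; apply. Qed.

Lemma ref_coarsest nu rho :
  equitable G rho -> finer rho pi ->
  (forall v, v \in nu -> singleton_cell rho v) -> finer rho (Ref G pi nu).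
Proof. by case: (HRef nu Gs pic) => _ [_ [_ [_ [+ _]]]]; apply. Qed.

Lemma ref_nth nu d i :
  uniq nu -> i < size nu -> Ref G pi nu (nth d nu i) = i.+1.
Proof.
by move=> un; case: (HRef nu Gs pic) => _ [_ [_ [_ [_ [+ _]]]]]; apply.
Qed.

End Refinement.

Lemma singletonP (V : finType) (rho : V -> nat) v :
  singleton_cell rho v <-> forall w, rho w = rho v -> w = v.
Proof.
split=> [sv w e|h].
  by apply/set1P; rewrite -sv inE e.
by apply/setP => w; rewrite !inE; apply/eqP/eqP => [/h|->].
Qed.

Section Necessity.
Variables (Ref : forall V : finType, rel V -> (V -> nat) -> seq V -> V -> nat).
Arguments Ref : clear implicits.
Hypothesis HRef : forall V : finType, refinement_spec (Ref V).
Variables (T : finType) (r : T) (p : T -> T).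

Lemma ir_node_rcons (V : finType) R Sel (G : rel V) pi nu v :
  ir_node R Sel G pi (rcons nu v) -> v \in Sel G (R G pi nu).
Proof.
move e: (rcons nu v) => mu h; case: h e => [|mu' v' _ hv] e.
  by have := congr1 size e; rewrite size_rcons.
by case/rcons_inj: e => -> ->.
Qed.

Lemma ir_tree_no_bad_node :
  is_IR_tree r p Ref -> ~ exists t, bad_node r p t.
Proof.
case=> V [G] [pi] [Sel] [Gs pic sel [f [finj nodes fr fp]]].
have childS t u : u \in children r p t ->
    exists2 v, f u = rcons (f t) v & v \in Sel G (Ref V G pi (f t)).
  rewrite inE => /andP[ur /eqP pu]; case: (fp u ur) => v; rewrite pu => e.
  exists v => //; apply: (@ir_node_rcons _ _ Sel); rewrite -e.
  by apply/nodes; exists u.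
have Schild t v : v \in Sel G (Ref V G pi (f t)) ->
    exists2 u, u \in children r p t & f u = rcons (f t) v.
  move=> hv; have : ir_node (Ref V) Sel G pi (rcons (f t) v).
    by apply: ir_child hv; apply/nodes; exists t.
  case/nodes=> u fu; exists u => //.
  have ur : u != r.
    by apply/eqP=> ur; have := congr1 size fu; rewrite ur fr size_rcons.
  case: (fp u ur) => w; rewrite fu => /rcons_inj[e _].
  by rewrite inE ur (finj _ _ e) eqxx.
have rc nu := ref_coloring (@HRef V) Gs pic nu.
have leafP u : is_leaf r p u <-> discrete (Ref V G pi (f u)).
  have [_ sd snd] := sel G (Ref V G pi (f u)) Gs (rc _); split=> [/eqP lu v|d].
    apply/singletonP => w e; apply/eqP; apply: contraT => nwv.
    case: snd => [d|_ S1].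
      by case/eqP: nwv; apply: (singletonP _ _).1 e; apply: d.
    have [v' /Schild[u']] : exists v', v' \in Sel G (Ref V G pi (f u)).
      by apply/set0Pn; rewrite -card_gt0; apply: leq_trans S1.
    by rewrite lu inE.
  apply/set0Pn => -[u' /childS[v _]].
  by rewrite (sd d) inE.
case=> t [c2 /eqP/cards1P[a la]].
have /setIdP[ca aleaf] : a \in [set u in children r p t | is_leaf r p u].
  by rewrite la set11.
have /eqP/cards1P[b eb] : #|children r p t :\ a| = 1.
  by have := cardsD1 a (children r p t); rewrite ca c2 add1n => -[].
have /setD1P[nba cb] : b \in children r p t :\ a by rewrite eb set11.
suff bleaf : is_leaf r p b.
  have : b \in [set u in children r p t | is_leaf r p u] by rewrite inE cb.
  by rewrite la inE (negPf nba).
have [va fa Sa] := childS _ _ ca; have [vb fb Sb] := childS _ _ cb.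
apply/leafP; move/leafP: aleaf => da.
(* One inclusion is enough: the refinement at the leaf [a] is discrete, and so is every colouring
   finer than it. *)
have fin : finer (Ref V G pi (f b)) (Ref V G pi (f a)).
  apply: (ref_coarsest (@HRef V) Gs pic) => [||v].
  - exact: (ref_equitable (@HRef V)).
  - exact: (ref_finer (@HRef V)).
  have sg w : w \in f b -> singleton_cell (Ref V G pi (f b)) w.
    exact: (ref_singleton (@HRef V)).
  rewrite fa mem_rcons inE => /orP[/eqP->|vt]; last first.
    by apply: sg; rewrite fb mem_rcons inE vt orbT.
  (* The refinement at [b] also refines the one at [t], whose selected cell consists of [va] and
     [vb]. As [vb] is a singleton at [b], nothing but [va] is left for [w]. *)
  apply/singletonP => w ew.
  have fin : finer (Ref V G pi (f b)) (Ref V G pi (f t)).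
    apply: (ref_coarsest (@HRef V) Gs pic) => [||v' hv'].
    - exact: (ref_equitable (@HRef V)).
    - exact: (ref_finer (@HRef V)).
    by apply: sg; rewrite fb mem_rcons inE hv' orbT.
  have [_ sd snd] := sel G (Ref V G pi (f t)) Gs (rc _).
  have nd : ~ discrete (Ref V G pi (f t)).
    by move=> d; move: Sa; rewrite (sd d) inE.
  have [[x Sx] _] := snd nd.
  have : w \in Sel G (Ref V G pi (f t)).
    by move: Sa; rewrite Sx !inE (fin _ _ ew).
  case/Schild=> u cu fu.
  have [ua|nua] := eqVneq u a.
    by move: fu; rewrite ua fa => /rcons_inj[].
  have : u \in children r p t :\ a by rewrite in_setD1 nua.
  rewrite eb => /set1P ub.
  move: fu; rewrite ub fb => /rcons_inj[evw].
  have /singletonP/(_ va) -> // : singleton_cell (Ref V G pi (f b)) vb.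
    by apply: sg; rewrite fb mem_rcons mem_head.
  by rewrite evw.
move=> v; apply/singletonP => w /fin e.
exact: (singletonP _ _).1 (da v) _ e.
Qed.

End Necessity.

(** * Cell selectors on rigid graphs *)

Definition rigid (V : finType) (G : rel V) : Prop :=
  forall phi : {perm V}, (forall x y, G (phi x) (phi y) = G x y) -> phi = 1%g.

Section Selector.
Variables (V : finType) (G : rel V) (I : finType) (P : pred I).
Variables (rho : I -> V -> nat) (X : I -> {set V}).
Hypothesis Grigid : rigid G.
Hypothesis rho_inj : forall i j, P i -> P j -> rho i =1 rho j -> X i = X j.
Hypothesis X_cell : forall i, P i -> is_cell (rho i) (X i).
Hypothesis X_gt1 : forall i, P i -> 1 < #|X i|.

Let matches (H : rel V) (col : V -> nat) (a : {perm V} * I) :=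
  [&& P a.2, [forall x, forall y, H x y == relabel_graph a.1 G x y]
    & [forall x, col x == relabel_col a.1 (rho a.2) x]].

(** Equivariant fallback for colourings unrelated to the prescribed ones: the non-singleton cell of
    smallest colour. *)
Let least_cell (col : V -> nat) :=
  [set v | (1 < #|cell col v|)
         && [forall w, (1 < #|cell col w|) ==> (col v <= col w)]].

Let sel (H : rel V) (col : V -> nat) : {set V} :=
  if [pick a | matches H col a] is Some a then a.1 @: X a.2 else least_cell col.

Let matchesP H col phi i :
  reflect [/\ P i, H =2 relabel_graph phi G & col =1 relabel_col phi (rho i)]
          (matches H col (phi, i)).
Proof.
apply: (iffP and3P) => [[Pi /forallP h1 /forallP h2]|[Pi h1 h2]].
  by split=> // [x y|x]; apply/eqP => //; apply: (forallP (h1 x)).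
split=> //; last by apply/forallP => x; rewrite h2.
by apply/forallP => x; apply/forallP => y; rewrite h1.
Qed.

(** Two matches of the same pair differ by an automorphism of [G], so by rigidity their permutations
    agree, and [rho_inj] makes their cells agree. Hence the choice made by [pick] is immaterial. *)
Let sel_matches H col phi i : matches H col (phi, i) -> sel H col = phi @: X i.
Proof.
rewrite /sel; case: pickP => [[psi j] /= mj|->//].
move=> /matchesP[Pi h1 h2]; move/matchesP: mj => [Pj k1 k2].
have e : (psi * phi^-1)%g = 1%g.
  apply: Grigid => x y; rewrite !permM.
  by have := h1 (psi x) (psi y); rewrite k1 /relabel_graph !permK => ->.
have {}e : psi = phi by apply/eqP; rewrite eq_mulgV1 e.
rewrite e (rho_inj Pj Pi) // => x.
by have := h2 (phi x); rewrite k2 e /relabel_col !permK.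
Qed.

Let card_relabel (phi : {perm V}) (col : V -> nat) x :
  #|cell (relabel_col phi col) x| = #|cell col ((phi^-1)%g x)|.
Proof.
rewrite -[RHS](card_imset _ (@perm_inj _ phi)); apply: eq_card => y.
rewrite inE; apply/eqP/imsetP => [e|[z + ->]].
  by exists ((phi^-1)%g y); rewrite ?permKV // inE; apply/eqP.
by rewrite inE /relabel_col permK => /eqP.
Qed.

Let least_relabel phi col :
  least_cell (relabel_col phi col) = phi @: least_cell col.
Proof.
apply/setP => x; rewrite -{2}(permKV phi x) mem_imset; last exact: perm_inj.
rewrite !inE card_relabel; congr (_ && _).
apply/forallP/forallP => h w.
  have := h (phi w); rewrite card_relabel permK => /implyP k.
  by apply/implyP => /k; rewrite /relabel_col permK.
by rewrite card_relabel; apply: h.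
Qed.

Let matches_relabel H col psi phi i :
  matches H col (phi, i) ->
  matches (relabel_graph psi H) (relabel_col psi col) ((phi * psi)%g, i).
Proof.
move/matchesP=> [Pi h1 h2]; apply/matchesP; split=> // [x y|x].
  by rewrite /relabel_graph h1 /relabel_graph invMg !permM.
by rewrite /relabel_col h2 /relabel_col invMg permM.
Qed.

(** Equivariance carries each prescribed cell to all relabellings of [G]. The pairs that match no
    prescription are closed under relabelling, so the fallback can be used on them independently. *)
Lemma rigid_selector :
  exists Sel, cell_selector Sel /\ forall i, P i -> Sel G (rho i) = X i.
Proof.
exists sel; split; last first.
  move=> i Pi; rewrite (@sel_matches _ _ 1%g i); last first.
    apply/matchesP; split=> // [x y|x].
      by rewrite /relabel_graph invg1 !perm1.
    by rewrite /relabel_col invg1 perm1.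
  rewrite -[RHS]imset_id; apply: eq_imset => x; exact: perm1.
move=> H col _ _; split=> [phi|disc|ndisc].
- case: (pickP (matches H col)) => [[psi i] m|nom].
    rewrite (sel_matches m) (sel_matches (matches_relabel phi m)).
    by rewrite -imset_comp; apply: eq_imset => x; rewrite permM.
  have -> : sel H col = least_cell col.
    by rewrite /sel; case: pickP => [a|//]; rewrite nom.
  rewrite -least_relabel /sel; case: pickP => [[psi i]|//].
  (* A match of the relabelled pair would pull back to a match of the original one. *)
  move/(matches_relabel phi^-1)/matchesP => [Pi h1 h2].
  have /negP[] := nom ((psi * phi^-1)%g, i); apply/matchesP; split=> // [x y|x].
    by rewrite -h1 /relabel_graph !invgK !permK.
  by rewrite -h2 /relabel_col !invgK !permK.
- rewrite /sel; case: pickP => [[psi i] /matchesP[Pi _ h2]|_].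
    (* A discrete colouring cannot match: [X i] would be a singleton cell. *)
    have [x Xx] := X_cell Pi.
    have := X_gt1 Pi; suff -> : X i = [set x] by rewrite cards1.
    apply/setP => y; rewrite Xx !inE; apply/eqP/eqP => [e|->//].
    have /setP/(_ (psi y)) := disc (psi x).
    rewrite !inE !h2 /relabel_col !permK e eqxx.
    by move/esym/eqP/perm_inj.
  apply/setP => x; rewrite !inE.
  by have := disc x; rewrite /singleton_cell => ->; rewrite cards1.
have card_sel : 1 < #|sel H col| -> is_cell col (sel H col) /\ 1 < #|sel H col|.
  move=> h; split=> //; move: h; rewrite /sel.
  case: pickP => [[psi i] /matchesP[Pi _ h2] _|_ h].
    have [x Xx] := X_cell Pi; exists (psi x); apply/setP => y.
    rewrite -{1}(permKV psi y) mem_imset; last exact: perm_inj.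
    by rewrite Xx !inE !h2 /relabel_col permK.
  have /set0Pn[x xin] : least_cell col != set0.
    by rewrite -card_gt0; apply: leq_trans h.
  exists x; move: xin; rewrite inE => /andP[x1 /forallP xl].
  apply/setP => y; rewrite !inE; apply/idP/eqP => [/andP[y1 /forallP yl]|e].
    by apply/eqP; rewrite eqn_leq (implyP (xl y)) ?(implyP (yl x)).
  have -> : cell col y = cell col x by apply/setP => z; rewrite !inE e.
  by rewrite x1; apply/forallP => w; rewrite e.
apply: card_sel; rewrite /sel.
case: pickP => [[psi i] /matchesP[Pi _ _]|_].
  by rewrite card_imset ?X_gt1 //; apply: perm_inj.
have [x x1] : exists x, 1 < #|cell col x|.
  apply/existsP; apply: contraT => /existsPn h; case: ndisc => v.
  apply/esym/eqP; rewrite eqEcard sub1set inE eqxx cards1 leqNgt; exact: h.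
pose y := [arg min_(z < x | 1 < #|cell col z|) col z].
have [y1 yl] : 1 < #|cell col y| /\ forall z, 1 < #|cell col z| -> col y <= col z.
  by rewrite /y; case: arg_minnP.
apply: (leq_trans y1); apply/subset_leq_card/subsetP => z.
rewrite !inE => /eqP e.
have -> : cell col z = cell col y by apply/setP => w; rewrite !inE e.
by rewrite y1; apply/forallP => w; apply/implyP; rewrite e; apply: yl.
Qed.

End Selector.

(** * Encoding colours in the graph *)

Section Palette.
Variables (V : finType) (A : rel V) (m : nat) (rk : V -> 'I_m).

(* A path is attached to the graph; its vertex [2i + 1] sees the vertices of
   rank [i], while its even inner vertices have degree 2, so that an
   automorphism fixing an initial segment also fixes the next vertex. The last
   vertex sees everything, which makes vertex 0 the only one of degree 1. *)
Definition palette_rel : rel (V + 'I_m.*2.+2) := fun x y =>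
  match x, y with
  | inl v, inl w => A v w
  | inl v, inr j | inr j, inl v =>
      (j == (rk v).*2.+1 :> nat) || (j == m.*2.+1 :> nat)
  | inr i, inr j => (i.+1 == j :> nat) || (j.+1 == i :> nat)
  end.

Lemma palette_simple : simple_graph A -> simple_graph palette_rel.
Proof.
move=> [As Ai]; split=> [[v|i] [w|j]|[v|i]] //=.
- by rewrite orbC.
- by rewrite gtn_eqF.
Qed.

Hypothesis A_nbr : forall v, exists w, A v w.
Variable v0 : V.

Section Automorphism.
Variable phi : {perm V + 'I_m.*2.+2}.
Hypothesis phiG : forall x y, palette_rel (phi x) (phi y) = palette_rel x y.

Let deg x := #|[set y | palette_rel x y]|.
Let pal n : V + 'I_m.*2.+2 := inr (inord n).

Let deg_phi x : deg (phi x) = deg x.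
Proof.
rewrite /deg -[RHS](card_imset _ (@perm_inj _ phi)); apply: eq_card => y.
rewrite -(permKV phi y) mem_imset; last exact: perm_inj.
by rewrite !inE phiG.
Qed.

Let colour_lt v : (rk v).*2.+1 < m.*2.
Proof. by rewrite -[_.+1]addn1 -!addnn; have := ltn_ord (rk v); lia. Qed.

(** Three neighbours: one given by [A_nbr], the path vertex encoding the rank, and the last path
    vertex. The degree thus separates [inl v] from the even path vertices. *)
Let deg_inl v : 2 < deg (inl v).
Proof.
have [w vw] := A_nbr v.
have lt := colour_lt v.
have lt' : (rk v).*2.+1 < m.*2.+2 by rewrite ltnS ltnW // ltnS ltnW.
suff <- : #|[set inl w; pal (rk v).*2.+1; pal m.*2.+1]| = 3.
  apply/subset_leq_card/subsetP => y; rewrite !inE => /orP[/orP[]|] /eqP-> //=.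
    by rewrite inordK ?eqxx.
  by rewrite inordK ?eqxx ?orbT.
rewrite -setUA cardsU1 cards2 !inE /=.
have -> // : pal (rk v).*2.+1 != pal m.*2.+1.
by apply/eqP => -[] /(congr1 val) /=; rewrite !inordK //; lia.
Qed.

Let deg_inr (j : 'I_m.*2.+2) : 0 < j -> 1 < deg (inr j).
Proof.
move=> j0; have [jm|jm] := eqVneq (val j) m.*2.+1.
  suff <- : #|[set inl v0; pal m.*2]| = 2.
    apply/subset_leq_card/subsetP => y; rewrite !inE => /orP[] /eqP-> /=.
      by rewrite jm eqxx orbT.
    by rewrite inordK ?jm ?eqxx ?orbT // leqnSn.
  by rewrite cards2.
have jl : j.+1 < m.*2.+2 by rewrite ltn_neqAle eqSS jm ltn_ord.
suff <- : #|[set pal j.-1; pal j.+1]| = 2.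
  apply/subset_leq_card/subsetP => y; rewrite !inE => /orP[] /eqP-> /=.
    by rewrite inordK prednK ?eqxx ?orbT // ltnW.
  by rewrite inordK ?eqxx.
rewrite cards2; case: eqP => // -[/(congr1 val)] /=.
by rewrite !inordK ?prednK //; [lia|exact: ltnW].
Qed.

Let deg_inr_even (j : 'I_m.*2.+2) : ~~ odd j -> deg (inr j) <= 2.
Proof.
move=> ej; have jl : j.+1 < m.*2.+2.
  rewrite ltn_neqAle ltn_ord andbT; apply: contraNneq ej => /eqP.
  by rewrite eqSS => /eqP->; rewrite /= odd_double.
apply: leq_trans (_ : #|[set pal j.-1; pal j.+1]| <= 2); last first.
  by rewrite cards2; case: eqP.
apply/subset_leq_card/subsetP => -[v|i]; rewrite !inE /=.
  by case/orP=> /eqP e; move: ej; rewrite e /= odd_double.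
case/orP=> /eqP e; apply/orP; [right|left]; apply/eqP; congr inr; apply/val_inj.
  by rewrite /= inordK // e.
by rewrite /= inordK -e //= ltn_ord.
Qed.

Let phi_inr_le n : forall i : 'I_m.*2.+2, i <= n -> phi (inr i) = inr i.
Proof.
elim: n => [|n IHn] i.
  rewrite leqn0 => /eqP i0.
  have d1 : deg (inr i) <= 1.
    apply: leq_trans (_ : #|[set pal 1]| <= 1); last by rewrite cards1.
    apply/subset_leq_card/subsetP => -[v|j]; rewrite !inE /= i0 //=.
    by case/orP=> // /eqP e; apply/eqP; congr inr; apply/val_inj; rewrite /= inordK // e.
  have := deg_phi (inr i); case e : (phi (inr i)) => [v|j] dj.
    by have := deg_inl v; rewrite dj ltnNge (leq_trans d1).
  case: (posnP j) => [j0|/deg_inr]; last by rewrite dj ltnNge d1.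
  by congr inr; apply/val_inj; rewrite /= i0 j0.
rewrite leq_eqVlt => /orP[/eqP ei|]; last by rewrite ltnS; apply: IHn.
have nl : n < m.*2.+2 by rewrite -ltnS -ei ltnS ltnW.
have := phiG (inr (Ordinal nl)) (inr i); rewrite [phi (inr (Ordinal nl))]IHn //=.
rewrite ei eqxx; case e : (phi (inr i)) => [v|j] /=.
  (* Since [n] is not the last path vertex, it sees [v] only if it is odd. Then [i] is even and has
     degree at most 2, which is too small for [v]. *)
  have nm : n != m.*2.+1 by rewrite neq_ltn -ltnS -ei ltn_ord.
  rewrite (negPf nm) orbF => /eqP en.
  have : deg (inr i) <= 2.
    by apply: deg_inr_even; rewrite ei en /= odd_double.
  by rewrite -deg_phi e leqNgt deg_inl.
case/orP=> /eqP ej; first by congr inr; apply/val_inj; rewrite /= ei ej.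
(* The image would be the predecessor of [n], which is already fixed. *)
have : phi (inr j) = phi (inr i) by rewrite e IHn // -ej.
by move/perm_inj=> -[]/(congr1 val) /=; lia.
Qed.

Lemma palette_aut_inr i : phi (inr i) = inr i.
Proof. exact: phi_inr_le (leqnn _). Qed.

(** With the path fixed pointwise, adjacency to its odd vertices reads off the rank. *)
Lemma palette_aut_inl v : exists2 w, phi (inl v) = inl w & rk w = rk v.
Proof.
case e : (phi (inl v)) => [w|i]; last first.
  by have : phi (inr i) = phi (inl v) by [rewrite palette_aut_inr e]; move/perm_inj.
exists w => //; apply/val_inj => /=.
have lt' : (rk v).*2.+1 < m.*2.+2 by rewrite ltnS ltnW // ltnS ltnW.
have := phiG (inl v) (pal (rk v).*2.+1); rewrite e palette_aut_inr /=.
rewrite inordK // eqxx [_ == m.*2.+1]ltn_eqF ?orbF; last first.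
  by rewrite ltnS ltnW.
by rewrite eqSS => /eqP/double_inj.
Qed.

End Automorphism.
End Palette.

(** * The gadget *)

(** Colours must fill an interval starting at 1, so the values taken are numbered by their position
    in a duplicate-free list. *)
Lemma coloring_of (V : finType) (C : eqType) (col : V -> C) :
  exists2 pi, is_coloring pi & forall v w, pi v = pi w <-> col v = col w.
Proof.
pose s := undup (codom col).
have ins v : col v \in s by rewrite mem_undup codom_f.
exists (fun v => (index (col v) s).+1) => [|v w]; last first.
  split=> [[e]|->//].
  by rewrite -(nth_index (col v) (ins v)) e nth_index.
exists (size s) => c; split=> [[v <-]|/andP[c0 cs]]; first by rewrite ltnS /= index_mem.
case: c c0 cs => // c _ cs.
have [x0] : {x0 : C | True} by case: (s) cs => // x0; exists x0.
have : nth x0 s c \in codom col by rewrite -mem_undup mem_nth.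
by case/codomP=> v e; exists v; rewrite -e index_uniq ?undup_uniq.
Qed.

(** An involution is injective, so each [F] gives one inequality between the neighbour counts;
    exchanging [v] and [w] gives the other. *)
Lemma equitable_of_involutions (V : finType) (G : rel V) (C : finType)
    (col : V -> C) :
  (forall v w, col v = col w -> exists2 F : V -> V, involutive F &
     forall u, G v u -> G w (F u) /\ col (F u) = col u) ->
  equitable G (fun v => enum_rank (col v)).
Proof.
move=> h.
suff le v w c : col v = col w ->
    #|[set u | G v u && (enum_rank (col u) == c :> nat)]|
      <= #|[set u | G w u && (enum_rank (col u) == c :> nat)]|.
  move=> v w /val_inj/enum_rank_inj e c.
  by apply/eqP; rewrite eqn_leq !le.
case/h=> F FK hF; rewrite -(card_imset _ (inv_inj FK)).
apply/subset_leq_card/subsetP => _ /imsetP[u + ->].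
by rewrite !inE => /andP[/hF[-> ->]].
Qed.

Lemma equitable_nbr (V : finType) (G : rel V) (rho : V -> nat) v w u :
  equitable G rho -> rho v = rho w -> G v u ->
  exists2 u', G w u' & rho u' = rho u.
Proof.
move=> eq /eq/(_ (rho u)) e vu.
have : 0 < #|[set x | G v x && (rho x == rho u)]|.
  by apply/card_gt0P; exists u; rewrite inE vu eqxx.
rewrite e => /card_gt0P[u']; rewrite inE => /andP[wu /eqP].
by exists u'.
Qed.

(** Core vertices on the left; on the right, the five slots of each query. *)
Definition slot_vertex (T : finType) : finType :=
  (T + (T * T * {ffun 'I_5 -> T}) * 'I_5)%type.

(** A slot displays the pair [(l, y)] of its query, one bit, the colours of the five entries and its
    position, but not the entries themselves. *)
Definition slot_colour (T D : finType) : finType :=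
  (D + T * T * bool * {ffun 'I_5 -> D} * 'I_5)%type.

Definition palette (T K : finType) : finType := 'I_(#|slot_colour T K|.*2.+2).

Definition gadget_vertex (T K : finType) : finType :=
  (slot_vertex T + palette T K)%type.

Section Gadget.
Variables (T K : finType) (kap : T -> K) (hot : pred T) (alt : T -> bool -> T).
Hypothesis alt_neq : forall l b, hot l -> alt l b != l.

Local Notation query := (T * T * {ffun 'I_5 -> T})%type.
Local Notation vertex := (gadget_vertex T K).
Local Notation slots := (slot_vertex T).

Definition pos n : 'I_5 := inord n.
(** Entries 1 and 2 may be exchanged with the sibling [alt l true], entries 3 and 4 with
    [alt l false]. *)
Definition alt_at l (k : 'I_5) := alt l (k < 3).

Definition parity (s : {ffun 'I_5 -> T}) : bool :=
  (s (pos 1) == s (pos 2)) (+) (s (pos 3) == s (pos 4)).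

(* In a query [(l, y, s)], a singleton [l] is meant to single out [y]. Only the
   queries with [hot l] matter. *)
Definition in_cube (q : query) : bool :=
  let: (l, y, s) := q in
  [&& hot l, s ord0 == y &
      [forall k, (k != ord0) ==> ((s k == l) || (s k == alt_at l k))]].

Definition twist (q : query) : bool := parity q.2 (+) in_cube q.

(** With [c] equal to [kap] this is the initial colouring; a finer [c] serves to individualize core
    vertices. *)
Definition colour (D : finType) (c : T -> D) (v : slots) : slot_colour T D :=
  match v with
  | inl x => inl (c x)
  | inr (q, k) => inr (q.1, twist q, [ffun i => c (q.2 i)], k)
  end.

(* The tuple of a query [q] is the clique of its slots [(q, k)], of which the
   [k]-th is adjacent to the [k]-th entry. *)
Definition slot_rel : rel slots := fun v w =>
  match v, w with
  | inl x, inr (q, k) | inr (q, k), inl x => q.2 k == x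
  | inr (q, k), inr (q', k') => (q == q') && (k != k')
  | _, _ => false
  end.

Definition rank v := enum_rank (colour kap v).

Definition gadget : rel vertex := palette_rel slot_rel rank.

Definition full_colour (D : finType) (c : T -> D) (v : vertex) :
    slot_colour T D + palette T K :=
  match v with inl v => inl (colour c v) | inr i => inr i end.

Lemma slot_simple : simple_graph slot_rel.
Proof.
split=> [[x|[q k]] [y|[q' k']]|[x|[q k]]] //=; last by rewrite !eqxx.
by rewrite eq_sym [k == _]eq_sym.
Qed.

Lemma gadget_simple : simple_graph gadget.
Proof. exact: palette_simple slot_simple. Qed.

(* Applied both to the classes of an equitable colouring in which a hot vertex
   is a singleton, and to the graph of an automorphism. *)
Section Simulation.
Variable R : vertex -> vertex -> Prop.
Hypothesis R_colour : forall v w, R v w -> full_colour kap v = full_colour kap w.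
Hypothesis R_nbr : forall v w u, R v w -> gadget v u ->
  exists2 u', gadget w u' & R u u'.

(** The colour preserves [(l, y)], the twist and the position. Walking along the clique to slot [i],
    then to its entry, relates the tuples entry by entry. *)
Lemma simulation_slot q k v :
  R (inl (inr (q, k))) v -> exists2 s, v = inl (inr ((q.1, s), k)) &
    twist (q.1, s) = twist q /\ forall i, R (inl (inl (q.2 i))) (inl (inl (s i))).
Proof.
move=> Rv; have := R_colour Rv.
case: v Rv => [[x|[[ly s] k']]|i] //= Rv [e1 e2 _ ek].
rewrite -{}e1 -{}ek in Rv e2 *; exists s => //; split=> // i.
have [s' R' <-] : exists2 s', R (inl (inr (q, i))) (inl (inr (q.1, s', i))) & s' = s.
  have [<-|nki] := eqVneq k i; first by exists s.
  have /(R_nbr Rv)[u + Ru] : gadget (inl (inr (q, k))) (inl (inr (q, i))).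
    by rewrite /gadget /= eqxx nki.
  have := R_colour Ru; case: u Ru => [[x|[q' i']]|j] //= Ru [_ _ _ ei].
  by case/andP=> /eqP e _; exists s => //; rewrite e [in X in R _ X]ei.
have /(R_nbr R')[u + Ru] : gadget (inl (inr (q, i))) (inl (inl (q.2 i))).
  by rewrite /gadget /=.
have := R_colour Ru; case: u Ru => [[x|[q' i']]|j] //= Ru _.
by rewrite /gadget /= => /eqP->.
Qed.

(** The tuple [(x, l, l, l, l)] is in the cube of [(l, x)] and has parity [false], so its twist is
    [true]. When [x] is related to [y], the related tuple starts with [y] and its other entries
    coincide, so its parity is [false] as well. Equal twists put it in the cube, which forces
    [y = x]. *)
Lemma simulation_id l :
  hot l ->
  (forall v w, R (inl (inl l)) v -> R (inl (inl l)) w -> v = w) ->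
  forall v w, R v w -> v = w.
Proof.
move=> hl Rl.
have core x y : R (inl (inl x)) (inl (inl y)) -> x = y.
  move=> Rxy; pose s := [ffun i : 'I_5 => if i == ord0 then x else l].
  have /(R_nbr Rxy)[u + Ru] : gadget (inl (inl x)) (inl (inr ((l, x, s), ord0))).
    by rewrite /gadget /= ffunE.
  have [s' -> [/= tw Rs]] := simulation_slot Ru.
  rewrite /gadget /= => /eqP s0.
  have Rli i : i != ord0 -> R (inl (inl l)) (inl (inl (s' i))).
    by move=> ni; have := Rs i; rewrite /s ffunE /= (negPf ni).
  have nz n : 0 < n < 5 -> pos n != ord0.
    by move=> /andP[n0 n5]; rewrite -val_eqE /= inordK // -lt0n.
  have eqs i j : 0 < i < 5 -> 0 < j < 5 -> s' (pos i) = s' (pos j).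
    by move=> /nz/Rli ri /nz/Rli rj; have [] := Rl _ _ ri rj.
  have ps : parity s = false by rewrite /parity !ffunE !(negPf (nz _ _)) // eqxx.
  have ps' : parity s' = false.
    by rewrite /parity (eqs 1 2) // (eqs 3 4) // !eqxx.
  have cs : in_cube (l, x, s).
    rewrite /in_cube hl ffunE !eqxx /=; apply/forallP => i; apply/implyP => ni.
    by rewrite ffunE (negPf ni) eqxx.
  move: tw; rewrite /twist ps ps' cs /= => /and3P[_ /eqP <- _].
  by rewrite s0.
move=> v w Rvw; case: v Rvw => [[x|[q k]]|i] Rvw.
- have := R_colour Rvw; case: w Rvw => [[y|[q k]]|j] //= Rvw _.
  by rewrite (core _ _ Rvw).
- have [s -> [_ Rs]] := simulation_slot Rvw; case: q Rs {Rvw} => ly s' /= Rs.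
  by have -> : s = s' by apply/ffunP => i; apply/esym/core.
have := R_colour Rvw; case: w Rvw => [[y|[q k]]|j] //= Rvw [e].
by rewrite e.
Qed.

End Simulation.

Lemma gadget_discrete l (rho : vertex -> nat) :
  hot l -> equitable gadget rho ->
  (forall v w, rho v = rho w -> full_colour kap v = full_colour kap w) ->
  singleton_cell rho (inl (inl l)) -> discrete rho.
Proof.
move=> hl eq fin /singletonP sl v; apply/singletonP => w.
apply: (@simulation_id (fun v w => rho v = rho w) _ _ l) => //.
- by move=> {}v {}w u e /(equitable_nbr eq e)[u' ? ?]; exists u'.
by move=> {}v {}w /esym/sl-> /esym/sl->.
Qed.

(** An automorphism relates [l] to a single vertex, which is all that [simulation_id] asks for; that
    [l] is fixed comes out as a consequence. *)
Lemma gadget_rigid l : hot l -> rigid gadget.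
Proof.
move=> hl phi phiG; apply/permP => v; rewrite perm1; apply/esym.
have nbr v' : exists w, slot_rel v' w.
  case: v' => [x|[q k]]; last by exists (inl (q.2 k)) => /=.
  by exists (inr ((l, l, [ffun=> x]), ord0)); rewrite /= ffunE.
have phil := palette_aut_inl nbr (inl l) phiG.
have phir := palette_aut_inr nbr (inl l) phiG.
apply: (@simulation_id (fun v w => phi v = w) _ _ l) => //.
- move=> {}v _ <-; case: v => [v|i]; last by rewrite phir.
  by have [w -> /enum_rank_inj e] := phil v; rewrite /= e.
- by move=> {}v _ u <- vu; exists (phi u); rewrite // phiG.
by move=> ? ? <-.
Qed.

(** * Equitability of the gadget *)

Lemma alt_at_pos l n : n < 5 -> alt_at l (pos n) = alt l (n < 3).
Proof. by move=> n5; rewrite /alt_at inordK. Qed.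

Lemma eq_pos m n : m < 5 -> n < 5 -> (pos m == pos n) = (m == n).
Proof. by move=> m5 n5; rewrite -val_eqE /= !inordK. Qed.

Lemma posP (k : 'I_5) :
  k != ord0 -> [\/ k = pos 1, k = pos 2, k = pos 3 | k = pos 4].
Proof.
have posE n (h : n < 5) : Ordinal h = pos n by apply/val_inj; rewrite /= inordK.
case: k => [[|[|[|[|[|//]]]]]] h // _; rewrite posE.
- exact: Or41.
- exact: Or42.
- exact: Or43.
exact: Or44.
Qed.

Definition swap_at (l : T) k (s : {ffun 'I_5 -> T}) : {ffun 'I_5 -> T} :=
  [ffun i => if i == k then tperm l (alt_at l k) (s i) else s i].

Lemma swap_atK l k : involutive (swap_at l k).
Proof. by move=> s; apply/ffunP => i; rewrite !ffunE; case: eqP; rewrite ?tpermK. Qed.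

Lemma in_cube_swap l y s k :
  k != ord0 -> in_cube (l, y, swap_at l k s) = in_cube (l, y, s).
Proof.
move=> nk; rewrite /in_cube ffunE [ord0 == k]eq_sym (negPf nk); congr [&& _, _ & _].
apply: eq_forallb => i; rewrite ffunE; have [->|//] := eqVneq i k.
by rewrite !(canF_eq (tpermK _ _)) tpermL tpermR orbC.
Qed.

(** Entry [k] occurs in exactly one of the two comparisons, between values in a two-element set, so
    exchanging these two values at [k] reverses its outcome. *)
Lemma parity_swap l y s k :
  in_cube (l, y, s) -> k != ord0 -> parity (swap_at l k s) = ~~ parity s.
Proof.
case/and3P=> hl _ /forallP cube nk.
have val n : 0 < n < 5 -> s (pos n) = l \/ s (pos n) = alt l (n < 3).
  case/andP=> n0 n5; have := cube (pos n).
  rewrite -val_eqE /= inordK // -lt0n n0 alt_at_pos //.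
  by case/orP=> /eqP; [left|right].
have neq b : (l == alt l b) = false by rewrite eq_sym (negPf (alt_neq _ hl)).
have [v1 v2 v3 v4] : [/\ s (pos 1) = l \/ s (pos 1) = alt l true,
    s (pos 2) = l \/ s (pos 2) = alt l true,
    s (pos 3) = l \/ s (pos 3) = alt l false &
    s (pos 4) = l \/ s (pos 4) = alt l false].
  by split; [exact: (val 1)|exact: (val 2)|exact: (val 3)|exact: (val 4)].
rewrite /parity !ffunE.
case: (posP nk) => ->; rewrite !eq_pos //= alt_at_pos //=; move: v1 v2 v3 v4;
  do 4!case=> ->; by rewrite ?tpermL ?tpermR ?eqxx ?neq ?[alt _ _ == l]eq_sym ?neq.
Qed.

Section Equitable.
Variables (D : finType) (c : T -> D).
Hypothesis c_kap : forall x y, c x = c y -> kap x = kap y.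
Hypothesis c_alt : forall l k, hot l ->
  exists k', [&& k' != k, k' != ord0 & c (alt_at l k') == c l].

(** A position other than [k] at which the exchange is invisible to [c]. The default [k] is not
    reached for hot [l]. *)
Let free l k :=
  odflt k [pick k' | [&& k' != k, k' != ord0 & c (alt_at l k') == c l]].

Let freeP l k : hot l ->
  [/\ free l k != k, free l k != ord0 & c (alt_at l (free l k)) = c l].
Proof.
move=> hl; rewrite /free; case: pickP => [k' /and3P[? ? /eqP //]|no].
by case: (c_alt k hl) => k'; rewrite no.
Qed.

(* A colour-preserving exchange of [twist] and [parity] that leaves entry [k]
   alone. *)
Let flip k (q : query) : query :=
  if in_cube q then (q.1, swap_at q.1.1 (free q.1.1 k) q.2) else q.

Let flip1 k q : (flip k q).1 = q.1.
Proof. by rewrite /flip; case: ifP. Qed.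

Let in_cube_flip k q : in_cube (flip k q) = in_cube q.
Proof.
rewrite /flip; case: ifP => // h; case: q h => [[l y] s] h.
by rewrite in_cube_swap //; case/and3P: (h) => /(freeP k)[].
Qed.

Let flipK k : involutive (flip k).
Proof.
move=> q; rewrite {1}/flip in_cube_flip flip1 /flip; case: ifP => h; rewrite h //.
by case: q {h} => ly s; rewrite /= swap_atK.
Qed.

Let parity_flip k q : parity (flip k q).2 = twist q.
Proof.
rewrite /twist /flip; case: ifP => h; rewrite ?addbF // addbT.
case: q h => [[l y] s] h /=; apply: (parity_swap h).
by case/and3P: (h) => /(freeP k)[].
Qed.

Let twist_flip k q : twist (flip k q) = parity q.2.
Proof. by rewrite -(parity_flip k) flipK. Qed.

Let c_flip k q i : c ((flip k q).2 i) = c (q.2 i).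
Proof.
rewrite /flip; case: ifP => //; case: q => [[l y] s] /= /and3P[/(freeP k)[_ _ e] _ _].
by rewrite ffunE; case: eqP => // ->; case: tpermP => // ->; rewrite e.
Qed.

Let flip_at k q : (flip k q).2 k = q.2 k.
Proof.
rewrite /flip; case: ifP => //; case: q => [[l y] s] /= /and3P[/(freeP k)[n _ _] _ _].
by rewrite ffunE eq_sym (negPf n).
Qed.

Let move_core x x' (q : query) : query :=
  (q.1, [ffun i => tperm x x' (q.2 i)]).

(** Renaming all entries by a transposition preserves the parity but may not preserve the twist;
    conjugation by [flip] turns one into the other, and leaves the action on entry [k] unchanged. *)
Let move x x' k q := flip k (move_core x x' (flip k q)).

Let moveK x x' k : involutive (move x x' k).
Proof.
have mK : involutive (move_core x x').
  move=> [ly s]; congr (_, _); apply/ffunP => i.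
  by rewrite !ffunE tpermK.
by move=> q; rewrite /move flipK mK flipK.
Qed.

Let twist_move x x' k q : twist (move x x' k q) = twist q.
Proof.
rewrite /move twist_flip -(parity_flip k q) /parity !ffunE.
by rewrite !(inj_eq perm_inj).
Qed.

Let c_move x x' k q i : c x = c x' -> c ((move x x' k q).2 i) = c (q.2 i).
Proof.
move=> e; rewrite c_flip ffunE -(c_flip k q).
by case: tpermP => // ->.
Qed.

Let move1 x x' k q : (move x x' k q).1 = q.1.
Proof. by rewrite flip1 /= flip1. Qed.

Let move_at x x' k q : (move x x' k q).2 k = tperm x x' (q.2 k).
Proof. by rewrite flip_at ffunE flip_at. Qed.

Lemma colour_kap v w : colour c v = colour c w -> colour kap v = colour kap w.
Proof.
case: v w => [x|[q k]] [y|[q' k']] //= [].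
  by move/c_kap->.
move=> -> -> /ffunP e ->.
suff -> : [ffun i => kap (q.2 i)] = [ffun i => kap (q'.2 i)] by [].
by apply/ffunP => i; rewrite !ffunE; apply: c_kap; have := e i; rewrite !ffunE.
Qed.

Lemma colour_full_kap (v w : vertex) :
  full_colour c v = full_colour c w -> full_colour kap v = full_colour kap w.
Proof. by case: v w => [v|i] [w|j] //= [e]; rewrite ?(colour_kap e) ?e. Qed.

Lemma gadget_equitable :
  equitable gadget (fun v : vertex => enum_rank (full_colour c v)).
Proof.
apply: equitable_of_involutions => -[v|i] [w|j] //= [e]; last first.
  by exists id => // u; rewrite e.
(* Equal ranks mean equal neighbours on the path, so only the slot part needs an involution. *)
have rk : rank v = rank w by rewrite /rank (colour_kap e).
suff [F FK hF] : exists2 F : slots -> slots, involutive F &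
    forall u, slot_rel v u -> slot_rel w (F u) /\ colour c (F u) = colour c u.
  exists (fun u => if u is inl u then inl (F u) else u) => [[u|i]|] //=.
    by rewrite FK.
  case=> [u|i] /=; first by case/hF=> ? ->.
  by rewrite rk.
case: v w e {rk} => [x|[q k]] [y|[q' k']] //= [].
  move=> e; exists (fun u => if u is inr (q, k) then inr (move x y k q, k) else u).
    by case=> [//|[q k]]; rewrite moveK.
  case=> [//|[q k]] /= /eqP qk; rewrite move_at qk tpermL eqxx; split=> //.
  rewrite move1 twist_move.
  suff -> : [ffun i => c ((move x y k q).2 i)] = [ffun i => c (q.2 i)] by [].
  by apply/ffunP => i; rewrite !ffunE c_move.
move=> e1 e2 e3 <-.
have e i : c (q.2 i) = c (q'.2 i) by have /ffunP/(_ i) := e3; rewrite !ffunE.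
(* For two slots at the same position: exchange their cliques and their entries. *)
exists (fun u => match u with
  | inr (q2, k) => inr (tperm q q' q2, k)
  | inl x => inl (tperm (q.2 k) (q'.2 k) x) end).
  by case=> [x|[q2 k2]]; rewrite tpermK.
case=> [x|[q2 k2]] /=.
  move/eqP<-; rewrite tpermL eqxx; split=> //.
  by rewrite e.
case/andP=> /eqP <- nk; rewrite tpermL eqxx nk; split=> //.
by rewrite e1 e2 e3.
Qed.

End Equitable.
End Gadget.

(** * Branches of the tree *)

Section Tree.
Variables (T : finType) (r : T) (p : T -> T).
Hypothesis Htree : rooted_tree r p.

Lemma tree_ind (P : T -> Prop) :
  P r -> (forall t, t != r -> P (p t) -> P t) -> forall t, P t.
Proof.
move=> Pr Pp t; have [_ /(_ t)[n]] := Htree; elim: n t => [|n IHn] t.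
  by move=> /= ->.
rewrite iterSr => /IHn Pt; have [->//|tr] := eqVneq t r; exact: Pp.
Qed.

Lemma reaches_root t : exists n, iter n p t == r.
Proof. by have [_ /(_ t)[n e]] := Htree; exists n; apply/eqP. Qed.

Definition depth t := ex_minn (reaches_root t).

Lemma depth_root : depth r = 0.
Proof.
by rewrite /depth; case: ex_minnP => n _ /(_ 0 (eqxx r)); rewrite leqn0 => /eqP.
Qed.

Lemma depth_parent t : t != r -> depth t = (depth (p t)).+1.
Proof.
move=> tr; rewrite /depth; case: ex_minnP => [[|n] e min] /=.
  by case/eqP: tr; apply/eqP.
rewrite iterSr in e; case: ex_minnP => m em minm.
apply/eqP; rewrite eqSS eqn_leq minm // andbT -ltnS.
by apply: min; rewrite iterSr.
Qed.

(* The root is not on the branch. *)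
Definition branch t := rev (traject p t (depth t)).

Lemma branch_root : branch r = [::].
Proof. by rewrite /branch depth_root. Qed.

Lemma branch_parent t : t != r -> branch t = rcons (branch (p t)) t.
Proof. by move=> tr; rewrite /branch depth_parent // trajectS rev_cons. Qed.

Lemma size_branch t : size (branch t) = depth t.
Proof. by rewrite size_rev size_traject. Qed.

Lemma branch_inj : injective branch.
Proof.
have size0 t : size (branch t) = 0 -> t = r.
  rewrite size_branch; have [//|tr] := eqVneq t r; by rewrite depth_parent.
move=> s t e; have [sr|sr] := eqVneq s r.
  by rewrite sr [t]size0 // -e sr branch_root.
have [tr|tr] := eqVneq t r; first by rewrite tr [s]size0 // e tr branch_root.
by move: e; rewrite (branch_parent sr) (branch_parent tr) => /rcons_inj[].
Qed.

Lemma branch_take t n :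
  n <= depth t -> exists s, branch s = take n (branch t).
Proof.
elim/tree_ind: t n => [|t tr IHt] n.
  by move=> _; exists r; rewrite branch_root.
rewrite leq_eqVlt => /orP[/eqP->|].
  by exists t; rewrite -size_branch take_size.
rewrite depth_parent // ltnS => nt; have [s e] := IHt _ nt; exists s.
by rewrite e [branch t]branch_parent // -cats1 takel_cat // size_branch.
Qed.

Lemma branch_depth t x : x \in branch t -> depth x <= depth t.
Proof.
elim/tree_ind: t => [|t tr IHt]; first by rewrite branch_root.
rewrite branch_parent // mem_rcons inE [depth t]depth_parent // => /orP[/eqP->|/IHt].
  by rewrite depth_parent.
exact: leqW.
Qed.

Lemma branch_uniq t : uniq (branch t).
Proof.
elim/tree_ind: t => [|t tr IHt]; first by rewrite branch_root.
rewrite branch_parent // rcons_uniq IHt andbT; apply/negP => /branch_depth.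
by rewrite depth_parent // ltnn.
Qed.

(** Siblings have equal depth, so a branch meets at most one of them. *)
Lemma branch_depth_inj t : {in branch t &, injective depth}.
Proof.
elim/tree_ind: t => [|t tr IHt] x y; first by rewrite branch_root.
rewrite branch_parent // !mem_rcons !inE.
case/orP=> [/eqP->|xt] /orP[/eqP->|yt] //; last exact: IHt.
  by rewrite depth_parent // => e; have := branch_depth yt; rewrite -e ltnn.
by rewrite [depth t]depth_parent // => e; have := branch_depth xt; rewrite e ltnn.
Qed.

Lemma branch_leaf t x : x \in branch t -> is_leaf r p x -> x = t.
Proof.
elim/tree_ind: t => [|t tr IHt]; first by rewrite branch_root.
rewrite branch_parent // mem_rcons inE => /orP[/eqP//|/IHt h lx].
move: (lx); rewrite (h lx) => /eqP/setP/(_ t).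
by rewrite !inE tr eqxx.
Qed.

Lemma child_notin_branch t x : x \in children r p t -> x \notin branch t.
Proof.
rewrite inE => /andP[xr /eqP <-]; apply/negP => /branch_depth.
by rewrite [depth x]depth_parent // ltnn.
Qed.

(** A non-root node of maximal depth; it supplies the hot vertex that makes the gadget rigid. *)
Lemma exists_leaf : ~~ is_leaf r p r -> exists2 l, l != r & is_leaf r p l.
Proof.
case/set0Pn=> x; rewrite inE => /andP[xr _].
pose l := [arg max_(y > x | y != r) depth y].
have [lr lmax] : l != r /\ forall y, y != r -> depth y <= depth l.
  by rewrite /l; case: arg_maxnP.
exists l => //; apply/set0Pn => -[y]; rewrite inE => /andP[yr /eqP pyl].
by have := lmax _ yr; rewrite depth_parent // pyl ltnn.
Qed.

Lemma leaf_root : is_leaf r p r -> forall t, t = r.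
Proof.
move=> /eqP/setP lr; elim/tree_ind => // t tr pt.
by have := lr t; rewrite !inE tr pt eqxx.
Qed.

(** Irreducibility provides one sibling of [l], and a second one is taken if there is any. Otherwise
    the parent has exactly two children, and as it is not bad, the sibling used twice is a leaf. *)
Lemma partners :
  irreducible_tree r p -> (forall t, ~ bad_node r p t) ->
  exists alt : T -> bool -> T, forall l, (l != r) && is_leaf r p l ->
    (forall b, [/\ alt l b != l, alt l b != r & p (alt l b) = p l])
    /\ (alt l true = alt l false -> is_leaf r p (alt l true)).
Proof.
move=> irr nbad; pose hot l := (l != r) && is_leaf r p l.
suff /fin_all_exists[a ha] : forall l, exists a : T * T, hot l ->
    [/\ a.1 \in children r p (p l) :\ l, a.2 \in children r p (p l) :\ l
      & a.1 = a.2 -> is_leaf r p a.1].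
  exists (fun l b => if b then (a l).1 else (a l).2) => l /ha[h1 h2 h3].
  split=> // b; move: h1 h2.
  by rewrite !inE => /and3P[? ? /eqP ?] /and3P[? ? /eqP ?]; case: b.
move=> l; case: (boolP (hot l)) => [/andP[lr ll]|_]; last by exists (r, r).
have cl : l \in children r p (p l) by rewrite inE lr eqxx.
have := irr (p l); rewrite (cardsD1 l) cl => n1.
have /set0Pn[x xl] : children r p (p l) :\ l != set0.
  by apply/eqP => e; case: n1; rewrite e cards0.
have [e|[y]] := set_0Vmem (children r p (p l) :\ l :\ x); last first.
  move=> /setD1P[yx yl]; exists (x, y) => _; split=> //= e.
  by rewrite e eqxx in yx.
exists (x, x) => _; split=> // _ /=; apply: contraT => nx.
have cx : x \in children r p (p l) by case/setD1P: xl.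
have nxl : x != l by case/setD1P: xl.
have c2 : #|children r p (p l)| = 2.
  by rewrite (cardsD1 l) cl (cardsD1 x) xl e cards0.
case: (nbad (p l)); split=> //; apply/eqP/cards1P; exists l; apply/setP => y.
apply/setIdP/set1P => [[cy ly]|->]; last by split.
apply: contraTeq ly => nyl; have [->//|nyx] := eqVneq y x.
by have := in_set0 y; rewrite -e !in_setD1 nyx nyl cy.
Qed.
End Tree.

(** * Sufficiency *)

Section Sufficiency.
Variables (Ref : forall V : finType, rel V -> (V -> nat) -> seq V -> V -> nat).
Arguments Ref : clear implicits.
Hypothesis HRef : forall V : finType, refinement_spec (Ref V).
Variables (T : finType) (r : T) (p : T -> T).
Hypothesis Htree : rooted_tree r p.

Lemma leaf_root_IR_tree : is_leaf r p r -> is_IR_tree r p Ref.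
Proof.
move=> /(leaf_root Htree) all_r.
(* The one-node tree comes from the empty graph, whose colouring uses no colour. *)
exists void, (fun _ _ => false), (fun=> 0), (fun _ _ => set0); split.
- by split; case.
- by exists 0 => c; split=> [[[]]|/andP[c0]]; rewrite leqNgt c0.
- by move=> G pi _ _; split=> // [phi|[]]; rewrite ?imset0 //; case.
exists (fun=> [::]); split=> //.
- by move=> s t _; rewrite (all_r s) (all_r t).
- move=> nu; split=> [_|[t <-]]; last exact: ir_root.
  by exists r; case: nu => // -[].
by move=> t; rewrite (all_r t) eqxx.
Qed.

Hypothesis Hirr : irreducible_tree r p.
Hypothesis Hbad : forall t, ~ bad_node r p t.
Hypothesis root_inner : ~~ is_leaf r p r.

(** The refinement at an inner node [t] is never computed: it lies between the colourings built from
    [c t] and [kap], and the children of [t] form a cell of both. *)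
Lemma inner_root_IR_tree : is_IR_tree r p Ref.
Proof.
have [alt altP] := partners Hirr Hbad.
pose hot l := (l != r) && is_leaf r p l.
pose kap t := if t == r then None else Some (p t).
have alt_neq l b : hot l -> alt l b != l by case/altP=> /(_ b)[].
have kap_child t x : (kap x == Some t) = (x \in children r p t).
  by rewrite /kap inE; case: (x == r).
have [l0 l0r l0leaf] := exists_leaf Htree root_inner.
have hot0 : hot l0 by rewrite /hot l0r.
pose G := gadget kap hot alt.
have Gs : simple_graph G by exact: gadget_simple.
have [pi pic piE] := coloring_of (full_colour hot alt kap : gadget_vertex T (option T) -> _).
pose V := gadget_vertex T (option T).
pose core (x : T) : V := inl (inl x).
have core_inj : injective core by move=> x y [].
pose f t := map core (branch Htree t).
have f_parent t : t != r -> f t = rcons (f (p t)) (core t).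
  by move=> tr; rewrite /f branch_parent // map_rcons.
have mem_f x t : (core x \in f t) = (x \in branch Htree t) by exact: mem_map.
have core_colour (D : finType) (c : T -> D) v x :
    full_colour hot alt c v = full_colour hot alt c (core x) ->
    exists2 y, v = core y & c y = c x.
  by case: v => [[y|[q k]]|i] //= [e]; exists y.
pose rho t := Ref V G pi (f t).
have rho_eq t : equitable G (rho t) by exact: (ref_equitable (@HRef V) Gs pic).
have rho_fin t : finer (rho t) pi by exact: (ref_finer (@HRef V) Gs pic).
have rho_sg t v : v \in f t -> singleton_cell (rho t) v.
  exact: (ref_singleton (@HRef V) Gs pic).
have rho_col t : is_coloring (rho t) by exact: (ref_coloring (@HRef V) Gs pic).
have leaf_discrete t : is_leaf r p t -> discrete (rho t).
  move=> tl; have [tr|tr] := eqVneq t r; first by rewrite tr (negPf root_inner) in tl.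
  apply: (@gadget_discrete _ _ kap hot alt t) => //.
  - by rewrite /hot tr.
  - by move=> v w /rho_fin/piE.
  by apply: rho_sg; rewrite f_parent // mem_rcons mem_head.
pose c t x := (kap x, if x \in branch Htree t then Some x else None).
have inner_finer t : ~~ is_leaf r p t ->
    finer (fun v : V => enum_rank (full_colour hot alt (c t) v)) (rho t).
  move=> tin.
  have c_kap x y : c t x = c t y -> kap x = kap y by case.
  apply: (ref_coarsest (@HRef V) Gs pic).
  - apply: gadget_equitable => // l k hl.
    have lnb : l \notin branch Htree t.
      apply/negP => lb; case/andP: (hl) => _ ll.
      by move: tin; rewrite -(branch_leaf lb ll) ll.
    have [altl alt_leaf] := altP _ hl.
    (* If both siblings were on the branch, they would coincide and be a leaf, but the branch of an
       inner node contains no leaf. *)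
    have [b bnb] : exists b, alt l b \notin branch Htree t.
      have [tb|] := boolP (alt l true \in branch Htree t); last by exists true.
      exists false; apply/negP => fb.
      have [_ t1 t2] := altl true; have [_ f1 f2] := altl false.
      have e : alt l true = alt l false.
        apply: (branch_depth_inj tb fb).
        by rewrite (depth_parent _ t1) (depth_parent _ f1) t2 f2.
      have ll := alt_leaf e.
      by move: tin; rewrite -(branch_leaf tb ll) ll.
    have calt : c t (alt l b) = c t l.
      rewrite /c (negPf lnb) (negPf bnb) /kap; case: (altl b) => _ /negPf-> ->.
      by case/andP: hl => /negPf->.
    (* Each sibling serves two positions, so one of them differs from [k]. *)
    have [i [j [nij i0 j0 ei ej]]] : exists i j : 'I_5, [/\ i != j, i != ord0,
        j != ord0, alt_at alt l i = alt l b & alt_at alt l j = alt l b].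
      clear calt bnb; case: b; [exists (pos 1), (pos 2)|exists (pos 3), (pos 4)];
        by rewrite !alt_at_pos // -!val_eqE /= !inordK.
    have [ik|nik] := eqVneq i k; last by exists i; rewrite nik i0 ei calt eqxx.
    by exists j; rewrite -ik eq_sym nij j0 ej calt eqxx.
  - by move=> v w /val_inj/enum_rank_inj/(colour_full_kap c_kap)/piE.
  move=> v /mapP[x xb ->]; apply/singletonP => w /val_inj/enum_rank_inj.
  case/core_colour=> y -> [_]; rewrite xb; case: ifP => // _ [->] //.
pose X t := core @: children r p t.
have X_cellE t w : ~~ is_leaf r p t -> w \in children r p t ->
    X t = cell (rho t) (core w).
  move=> tin wt; apply/setP => v; rewrite inE; apply/imsetP/eqP.
    case=> x xt ->; apply: (inner_finer _ tin); congr (nat_of_ord (enum_rank _)).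
    rewrite /= /c (negPf (child_notin_branch _ xt)).
    rewrite (negPf (child_notin_branch _ wt)).
    move: (xt) (wt); rewrite -!kap_child => /eqP-> /eqP-> //.
  move/rho_fin/piE/core_colour=> [x -> e]; exists x => //.
  by rewrite -kap_child e kap_child.
have has_child t : ~~ is_leaf r p t -> exists w, w \in children r p t.
  by case/set0Pn=> w; exists w.
have X_gt1 t : ~~ is_leaf r p t -> 1 < #|X t|.
  move=> tin; rewrite card_imset // ltn_neqAle eq_sym card_gt0 tin andbT.
  by apply/eqP/Hirr.
(* Needed for the prescribed cells to be consistent. The individualization colours make [f s] a
   prefix of [f t]; were it proper, its next vertex would be a singleton for [t] but lie in the cell
   [X s] for [s]. *)
have rho_inj s t : ~~ is_leaf r p s -> ~~ is_leaf r p t -> rho s =1 rho t -> s = t.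
  have f_uniq u : uniq (f u) by rewrite map_inj_uniq // branch_uniq.
  have size_f u : size (f u) = depth Htree u by rewrite size_map size_branch.
  wlog le : s t / depth Htree s <= depth Htree t.
    by move=> h; case: (leqP (depth Htree s) (depth Htree t)) => [|/ltnW] le;
       [exact: h|move=> sin tin e; apply/esym/h => // v; rewrite e].
  move=> sin tin e.
  have pre : f s = take (depth Htree s) (f t).
    apply: (@eq_from_nth _ (core r)) => [|i].
      by rewrite size_takel size_f.
    rewrite size_f => ilt; rewrite nth_take //.
    have ilt' : i < depth Htree t by exact: leq_trans le.
    have ti : nth (core r) (f t) i \in f t by rewrite mem_nth ?size_f.
    apply: (singletonP _ _).1 (rho_sg _ _ ti) _ _.
    by rewrite -e /rho !(ref_nth (@HRef V) Gs pic) ?size_f.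
  have bpre : branch Htree s = take (depth Htree s) (branch Htree t).
    by apply: (inj_map core_inj); rewrite map_take.
  case: (ltngtP (depth Htree s) (depth Htree t)) le => // [lt|eqd] _.
    have [x ex] := branch_take lt.
    have xr : x != r.
      apply/eqP => xr; have := congr1 size ex.
      by rewrite xr branch_root size_takel // size_branch.
    have xt : x \in branch Htree t.
      apply: (@mem_take (depth Htree s).+1); rewrite -ex.
      by rewrite branch_parent // mem_rcons mem_head.
    have pxs : p x = s.
      apply: (@branch_inj _ _ _ Htree).
      move: ex; rewrite branch_parent // (take_nth x) ?size_branch // -bpre.
      by case/rcons_inj.
    have xs : x \in children r p s by rewrite inE xr pxs eqxx.
    have := X_gt1 _ sin; rewrite (X_cellE _ _ sin xs).
    have -> : cell (rho s) (core x) = cell (rho t) (core x).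
      by apply/setP => v; rewrite !inE !e.
    by rewrite rho_sg ?mem_f // cards1.
  by apply: (@branch_inj _ _ _ Htree); rewrite bpre eqd -size_branch take_size.
have [Sel [selP SelX]] : exists Sel, cell_selector Sel /\
    forall t, ~~ is_leaf r p t -> Sel G (rho t) = X t.
  apply: rigid_selector => [|s t sin tin e|t tin|t] //.
  - exact: gadget_rigid hot0.
  - by rewrite (rho_inj s t).
  - by have [w wt] := has_child _ tin; exists (core w); apply: X_cellE.
  exact: X_gt1.
(* At a leaf both sides are empty, the refinement being discrete. *)
have SelE t : Sel G (rho t) = X t.
  have [tl|] := boolP (is_leaf r p t); last exact: SelX.
  have [_ -> //] := selP G (rho t) Gs (rho_col t); last exact: leaf_discrete.
  by rewrite /X (eqP tl) imset0.
exists V, G, pi, Sel; split=> //; exists f; split.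
- by move=> s t /(inj_map core_inj)/branch_inj.
- move=> nu; split.
    elim=> [|{}nu v _ [t <-]]; first by exists r; rewrite /f branch_root.
    rewrite -/(rho t) SelE => /imsetP[x + ->]; rewrite inE => /andP[xr /eqP <-].
    by exists x; rewrite f_parent.
  case=> t <-; elim/(tree_ind Htree): t => [|t tr IHt].
    by rewrite /f branch_root; apply: ir_root.
  rewrite f_parent //; apply: ir_child IHt _; rewrite -/(rho (p t)) SelE.
  by rewrite imset_f // inE tr eqxx.
- by rewrite /f branch_root.
by move=> t tr; exists (core t); rewrite f_parent.
Qed.

End Sufficiency.

Theorem theorem1
  (Ref : forall V : finType, rel V -> (V -> nat) -> seq V -> V -> nat)
  (HRef : forall V : finType, refinement_spec (Ref V))
  (T : finType) (r : T) (p : T -> T)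
  (Htree : rooted_tree r p) (Hirr : irreducible_tree r p) :
  is_IR_tree r p Ref <-> ~ (exists t : T, bad_node r p t).
Proof.
split=> [|nbad]; first exact: ir_tree_no_bad_node.
have [lr|ir] := boolP (is_leaf r p r); first exact: leaf_root_IR_tree.
by apply: inner_root_IR_tree => // t bt; apply: nbad; exists t.
Qed.
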